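(* If $X$ is a nonnegative random variable with support $(0,l)$, $0<l<\infty$, and with finite cumulative entropy $CE(X)$, then $$CE_{\alpha}(X)\le\frac{l^{1-\alpha}}{\Gamma(\alpha+1)}\,(CE(X))^{\alpha}\quad\text{if } 0<\alpha\le 1,$$ $$CE_{\alpha}(X)\ge\frac{l^{1-\alpha}}{\Gamma(\alpha+1)}\,(CE(X))^{\alpha}\quad\text{if } \alpha\ge 1.$$
   Context: With $F$ the cumulative distribution function of $X$: the cumulative entropy is $CE(X)=-\int_0^l F(x)\ln F(x)\,dx$, and the fractional generalized cumulative entropy of order $\alpha>0$ is $CE_{\alpha}(X)=\frac{1}{\Gamma(\alpha+1)}\int_{0}^{l}F(x)[-\ln F(x)]^{\alpha}\,dx$. *)

(* Defs.v *)
From mathcomp Require Import all_boot all_order all_algebra.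
From mathcomp Require Import all_classical all_reals all_analysis.

Set Implicit Arguments.
Unset Strict Implicit.
Unset Printing Implicit Defensive.

Import Order.TTheory GRing.Theory Num.Theory.
Import numFieldNormedType.Exports.

Local Open Scope classical_set_scope.
Local Open Scope ring_scope.

(* Euler's Gamma function, meaningful for 0 < s. *)
Definition Gamma (R : realType) (s : R) : R :=
  \int[@lebesgue_measure R]_(t in `]0, +oo[) (t `^ (s - 1) * expR (- t)).

(* The topological support of the law of X: the points all of whose open
   neighbourhoods have positive probability.  It is always closed, so "X has
   support (0, l)" reads: rv_support X = closure `]0, l[. *)
Definition rv_support (d : measure_display) (T : measurableType d) (R : realType)
    (P : probability T R) (X : {RV P >-> R}) : set R :=
  [set x | forall U : set R, open_nbhs x U -> (0 < distribution P X U)%E].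

(* The cdf of the library takes values in \bar R. *)
Definition rcdf (d : measure_display) (T : measurableType d) (R : realType)
    (P : probability T R) (X : {RV P >-> R}) (x : R) : R :=
  fine (cdf X x).

(* The library has ln 0 = 0, hence the usual convention 0 * ln 0 = 0.
   Entropies are extended reals, so that finiteness is not built in. *)
Definition CE (d : measure_display) (T : measurableType d) (R : realType)
    (P : probability T R) (X : {RV P >-> R}) (l : R) : \bar R :=
  (- \int[@lebesgue_measure R]_(x in `[0%R, l])
       (rcdf X x * ln (rcdf X x))%:E)%E.

Definition fractional_CE (d : measure_display) (T : measurableType d)
    (R : realType) (P : probability T R) (X : {RV P >-> R}) (l alpha : R) :
    \bar R :=
  ((1 / Gamma (alpha + 1))%:E *
   \int[@lebesgue_measure R]_(x in `[0%R, l])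
     (rcdf X x * (- ln (rcdf X x)) `^ alpha)%:E)%E.

(* Main.v *)
Require Import Defs.
From mathcomp Require Import all_boot all_order all_algebra.
From mathcomp Require Import all_classical all_reals all_analysis.
From mathcomp Require Import measurable_realfun.
Import Order.TTheory GRing.Theory Num.Theory.
Import numFieldNormedType.Exports.
Local Open Scope classical_set_scope.
Local Open Scope ring_scope.

(** With [g = F (- ln F)], the inequality [F <= F `^ alpha] (for [alpha <= 1],
    reversed for [alpha >= 1]) on [0 <= F <= 1] compares the integrand
    [F (- ln F) `^ alpha] with [g `^ alpha]; Hölder's inequality on [[0, l]]
    with exponent [1 / alpha] (resp. [alpha]) then compares the integral of
    [g `^ alpha] with [l `^ (1 - alpha)] times the [alpha]-th power of the
    integral of [g]. *)

Lemma integral_le_powR_mean (d : measure_display) (T : measurableType d)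
    (R : realType) (mu : {measure set T -> \bar R}) (D : set T) (h : T -> R)
    (p : R) :
  measurable D -> measurable_fun [set: T] h -> (forall x, 0 <= h x) ->
  1 <= p ->
  (\int[mu]_(x in D) (h x)%:E <=
   mu D `^ (1 - p^-1) * (\int[mu]_(x in D) (h x `^ p)%:E) `^ p^-1)%E.
Proof.
(* The case [p = 1] is an equality, set apart because the conjugate exponent [(1 - p^-1)^-1] would
   be [0^-1 = 0], which Hölder's inequality excludes. *)
move=> mD mh h0; rewrite le_eqVlt => /predU1P[<-|p1].
  rewrite invr1 subrr poweRe0 mul1e poweRe1; last first.
    by apply: integral_ge0 => x _; rewrite lee_fin powR_ge0.
  by under [leRHS]eq_integral do rewrite powRr1//.
have p0 : 0 < p by rewrite (lt_trans ltr01).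
have q0 : 0 < 1 - p^-1 by rewrite subr_gt0 invf_lt1.
have m1 : measurable_fun [set: T] (\1_D : T -> R) by exact: measurable_indic.
(* Hölder for the pair [\1_D] and [h \* \1_D]: the norm of the first factor yields the power of
   [mu D], and the indicators turn integrals over the whole space into integrals over [D]. *)
have := @hoelder _ _ _ mu (\1_D : T -> R) (h \* \1_D)%R (1 - p^-1)^-1 p
  m1 (measurable_funM mh m1).
rewrite !invr_gt0 invrK subrK => /(_ q0 p0 erefl).
rewrite unlock /= invr1 poweRe1; last first.
  by apply: integral_ge0 => x _; rewrite lee_fin powR_ge0.
rewrite invrK.
have -> : (\int[mu]_x (`|\1_D x * (h x * \1_D x)| `^ 1)%:E =
           \int[mu]_(x in D) (h x)%:E)%E.
  rewrite [RHS]integral_mkcond; apply: eq_integral => x _.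
  rewrite /patch indicE powRr1//.
  by case: (x \in D); rewrite ?mulr1 ?mul1r ?mul0r ?normr0// ger0_norm.
have -> : (\int[mu]_x (`|\1_D x| `^ (1 - p^-1)^-1)%:E = mu D)%E.
  rewrite -[RHS]mul1e -integral_cst// [RHS]integral_mkcond.
  apply: eq_integral => x _; rewrite /patch indicE.
  (* Off [D] the power of 0 vanishes only for a nonzero exponent, since 0 to the power 0 is 1. *)
  by case: (x \in D); rewrite ?normr1 ?powR1// normr0 powR0// invr_neq0// gt_eqF.
have -> // : (\int[mu]_x (`|h x * \1_D x| `^ p)%:E =
           \int[mu]_(x in D) (h x `^ p)%:E)%E.
rewrite [RHS]integral_mkcond; apply: eq_integral => x _.
rewrite /patch indicE.
by case: (x \in D); rewrite ?mulr1 ?mulr0 ?normr0 ?powR0 ?gt_eqF// ger0_norm.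
Qed.

Lemma le1_mul_powR (R : realType) (u v a : R) :
  0 <= u <= 1 -> 0 <= v -> 0 < a <= 1 -> u * v `^ a <= (u * v) `^ a.
Proof.
move=> /andP[u0 u1] v0 /andP[a0 a1]; rewrite powRM// ler_wpM2r ?powR_ge0//.
move: u0; rewrite le_eqVlt => /predU1P[<-|u0]; first exact: powR_ge0.
by rewrite ger1_powR// u0.
Qed.

Lemma ge1_mul_powR (R : realType) (u v a : R) :
  0 <= u <= 1 -> 0 <= v -> 1 <= a -> (u * v) `^ a <= u * v `^ a.
Proof.
move=> /andP[u0 u1] v0 a1.
move: u0; rewrite le_eqVlt => /predU1P[<-|u0].
  by rewrite !mul0r powR0// gt_eqF// (lt_le_trans ltr01).
by rewrite ge1r_powRZ// u0.
Qed.

Section cumulative_entropy.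
Variables (R : realType) (d : measure_display) (T : measurableType d).
Variables (P : probability T R) (X : {RV P >-> R}).

Lemma rcdf_itv x : 0 <= rcdf X x <= 1.
Proof.
rewrite fine_ge0 ?cdf_ge0//= -lee_fin fineK ?cdf_le1//.
by rewrite /cdf fin_num_measure.
Qed.

Lemma measurable_rcdf : measurable_fun [set: R] (rcdf X).
Proof. exact: measurableT_comp (@cdf_measurable _ _ _ P X). Qed.

(** Comes from [rcdf X x <= 1]; where the distribution function vanishes, [ln 0 = 0] keeps the
    bound. *)
Lemma oppr_ln_rcdf_ge0 x : 0 <= - ln (rcdf X x).
Proof. by have /andP[_ F1] := rcdf_itv x; rewrite oppr_ge0 ln_le0. Qed.

Lemma measurable_oppr_ln_rcdf :
  measurable_fun [set: R] (fun x => - ln (rcdf X x)).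
Proof.
apply: measurableT_comp => //.
exact: measurableT_comp (@measurable_ln R) measurable_rcdf.
Qed.

(** The integrand has constant sign, so the minus sign passes through the extended integral even
    when it is infinite. *)
Lemma CE_integral l :
  CE X l =
  (\int[@lebesgue_measure R]_(x in `[0%R, l]) (rcdf X x * - ln (rcdf X x))%:E)%E.
Proof.
rewrite /CE -[RHS]oppeK; congr (- _)%E.
rewrite -integral_ge0N.
  by apply: eq_integral => x _; rewrite mulrN EFinN oppeK.
move=> x _; have /andP[F0 _] := rcdf_itv x.
by rewrite lee_fin mulr_ge0 ?oppr_ln_rcdf_ge0.
Qed.

End cumulative_entropy.

(** Lets the common factor [(Gamma (alpha + 1))^-1] be removed from both inequalities. *)
Lemma Gamma_ge0 (R : realType) (s : R) : 0 <= Gamma s.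
Proof.
by apply: Rintegral_ge0 => t _; rewrite mulr_ge0 ?powR_ge0 ?expR_ge0.
Qed.

Theorem proposition3p2 (R : realType) (d : measure_display)
    (T : measurableType d) (P : probability T R) (X : {RV P >-> R})
    (l alpha : R) :
  0 < l ->
  (forall t : T, 0 <= X t) ->
  rv_support X = closure (`]0, l[ : set R) ->
  CE X l \is a fin_num ->
  (0 < alpha <= 1 ->
     (fractional_CE X l alpha <=
      (l `^ (1 - alpha) / Gamma (alpha + 1))%:E * (CE X l `^ alpha))%E) /\
  (1 <= alpha ->
     (fractional_CE X l alpha >=
      (l `^ (1 - alpha) / Gamma (alpha + 1))%:E * (CE X l `^ alpha))%E).
Proof.
move=> l0 _ _ _.
have mI : measurable (`[0, l] : set R) by [].
have muI : @lebesgue_measure R `[0, l] = l%:E.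
  by rewrite lebesgue_measure_itv/= lte_fin l0 oppr0 adde0.
have hoelderI (h : R -> R) (p : R) : measurable_fun [set: R] h ->
    (forall x, 0 <= h x) -> 1 <= p ->
    (\int[@lebesgue_measure R]_(x in `[0%R, l]) (h x)%:E <=
     (l `^ (1 - p^-1))%:E *
     (\int[@lebesgue_measure R]_(x in `[0%R, l]) (h x `^ p)%:E) `^ p^-1)%E.
  by move=> mh h0 p1; rewrite -poweR_EFin -muI; exact: integral_le_powR_mean.
pose F := rcdf X; pose g x := F x * - ln (F x).
have mF := measurable_rcdf _ _ _ _ X; have mL := measurable_oppr_ln_rcdf _ _ _ _ X.
have FI x : 0 <= F x <= 1 := rcdf_itv _ _ _ _ X x.
have L0 x : 0 <= - ln (F x) := oppr_ln_rcdf_ge0 _ _ _ _ X x.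
have g0 x : 0 <= g x by have /andP[? _] := FI x; rewrite mulr_ge0.
have mg : measurable_fun [set: R] g by exact: measurable_funM.
have mgp : measurable_fun [set: R] (fun x => g x `^ alpha).
  exact: measurableT_comp (@measurable_powR R alpha) mg.
have mFL : measurable_fun [set: R] (fun x => F x * (- ln (F x)) `^ alpha).
  apply: measurable_funM => //.
  exact: measurableT_comp (@measurable_powR R alpha) mL.
have FL0 x : 0 <= F x * (- ln (F x)) `^ alpha.
  by have /andP[? _] := FI x; rewrite mulr_ge0 ?powR_ge0.
have Gam0 : (0 <= ((Gamma (alpha + 1))^-1)%:E)%E.
  by rewrite lee_fin invr_ge0 Gamma_ge0.
pose J := (\int[@lebesgue_measure R]_(x in `[0%R, l]) (g x `^ alpha)%:E)%E.
rewrite /fractional_CE CE_integral -/F -/g.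
rewrite mul1r (mulrC (l `^ _)) EFinM -muleA.
split=> [/andP[a0 a1]|a1]; rewrite lee_wpmul2l//.
- apply: (@le_trans _ _ J).
    apply: ge0_le_integral => //.
    + by move=> x _; rewrite lee_fin.
    + by apply/measurable_EFinP; exact: measurable_funTS.
    + by apply/measurable_EFinP; exact: measurable_funTS.
    + by move=> x _; rewrite lee_fin le1_mul_powR// a0.
  (* With this exponent, [(g x]^ alpha) [^ alpha^-1] is [g x], so the right-hand integral becomes
     that of [g]. *)
  have := hoelderI _ alpha^-1 mgp (fun x => powR_ge0 _ _).
  rewrite invf_ge1// => /(_ a1); rewrite invrK.
  under [X in is_true (_ <= _ * X `^ _)%E -> _]eq_integral do
    rewrite -powRrM mulfV ?gt_eqF// powRr1//.
  exact.
- have a0 : 0 < alpha by exact: lt_le_trans a1.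
  apply: (@le_trans _ _ J); last first.
    apply: ge0_le_integral => //.
    + by move=> x _; rewrite lee_fin powR_ge0.
    + by apply/measurable_EFinP; exact: measurable_funTS.
    + by apply/measurable_EFinP; exact: measurable_funTS.
    + by move=> x _; rewrite lee_fin ge1_mul_powR.
  have := hoelderI _ _ mg g0 a1.
  set I := (X in (_ <= _ * X `^ _)%E -> _).
  have I0 : (0 <= I)%E by apply: integral_ge0 => x _; rewrite lee_fin powR_ge0.
  set G := (X in (X <= _)%E -> _).
  have G0 : (0 <= G)%E by apply: integral_ge0 => x _; rewrite lee_fin.
  move=> /(gt0_ler_poweR (ltW a0)).
  rewrite !in_itv/= G0 !leey mule_ge0 ?lee_fin ?powR_ge0 ?poweR_ge0//.
  move=> /(_ isT isT).
  rewrite poweRM ?lee_fin ?powR_ge0 ?poweR_ge0// -poweRrM mulVf ?gt_eqF// poweRe1//.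
  rewrite poweR_EFin -powRrM mulrBl mul1r mulVf ?gt_eqF// => GI.
  apply: (le_trans (lee_wpmul2l _ GI)); first by rewrite lee_fin powR_ge0.
  (* The exponents add up to 0, a case in which the addition rule requires a nonzero base, hence
     [0 < l]. *)
  rewrite muleA -EFinM -powRD ?(gt_eqF l0) ?implybT//.
  by rewrite addrA subrK subrr powRr0 mul1e.
Qed.
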